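(* Over $\mathbf{ZF}$, the Axiom of Countable Choice $\mathbf{AC}_\omega$ is equivalent to the statement: ''Every Veloso problem whose set of instances is countable has a solution function.''
   Context: The base theory is $\mathbf{ZF}$ (no choice is assumed). The Axiom of Countable Choice $\mathbf{AC}_\omega$ asserts: every countable family of non-empty sets has a choice function, i.e. if $\{X_n:n\in\mathbb{N}\}$ is a countable family of non-empty sets, then there is a function $f:\{X_n:n\in\mathbb{N}\}\to\bigcup_{n\in\mathbb{N}}X_n$ such that $f(X_n)\in X_n$ for all $n\in\mathbb{N}$. A Kolmogorov problem is a triple $P=(I,S,\sigma)$ where $I$ and $S$ are sets (the set of instances and the set of possible solutions) and $\sigma\subseteq I\times S$ is a relation; $z\,\sigma\,s$ is read ''$s$ solves $z$''. $P$ is viable if for every $z\in I$ there is $s\in S$ with $z\,\sigma\,s$. $P$ is non-generic if for every $s\in S$ there is $z\in I$ with $\neg(z\,\sigma\,s)$. A Veloso problem is a Kolmogorov problem $(I,S,\sigma)$, with $I$ and $S$ non-empty sets (of arbitrary size), that is viable and non-generic. A solution function for a viable Kolmogorov problem $P=(I,S,\sigma)$ is a function $f:I\to S$ with $f\subseteq\sigma$, i.e. $z\,\sigma\,f(z)$ for every $z\in I$. *)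

(* Defs.v *)
From Stdlib Require Import List Arith.

(** * Classical first-order logic with equality in the language {∈}

    Terms are variables, as de Bruijn indices; hence substitution is renaming. *)

Inductive form : Type :=
| Fal
| Eq (x y : nat)
| Mem (x y : nat)
| Imp (p q : form)
| All (p : form).

Definition Neg p := Imp p Fal.
Definition Or p q := Imp (Neg p) q.
Definition And p q := Neg (Imp p (Neg q)).
Definition Iff p q := And (Imp p q) (Imp q p).
Definition Ex p := Neg (All (Neg p)).

Definition up (r : nat -> nat) (k : nat) : nat :=
  match k with 0 => 0 | S k => S (r k) end.

Fixpoint ren (r : nat -> nat) (p : form) : form :=
  match p with
  | Fal => Fal
  | Eq x y => Eq (r x) (r y)
  | Mem x y => Mem (r x) (r y)
  | Imp p q => Imp (ren r p) (ren r q)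
  | All p => All (ren (up r) p)
  end.

Definition inst (t : nat) : form -> form :=
  ren (fun k => match k with 0 => t | S k => k end).

Inductive prv : list form -> form -> Prop :=
| prv_ctx G p : In p G -> prv G p
| prv_impI G p q : prv (p :: G) q -> prv G (Imp p q)
| prv_impE G p q : prv G (Imp p q) -> prv G p -> prv G q
| prv_raa G p : prv (Neg p :: G) Fal -> prv G p
| prv_allI G p : prv (map (ren S) G) p -> prv G (All p)
| prv_allE G p t : prv G (All p) -> prv G (inst t p)
| prv_eq_refl G x : prv G (Eq x x)
| prv_eq_subst G p x y : prv G (Eq x y) -> prv G (inst x p) -> prv G (inst y p).

Definition provable (T : form -> Prop) (p : form) : Prop :=
  exists G, (forall q, In q G -> T q) /\ prv G p.

(** All free variables of [p] are below [bound p]. *)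
Fixpoint bound (p : form) : nat :=
  match p with
  | Fal => 0
  | Eq x y | Mem x y => Nat.max (S x) (S y)
  | Imp p q => Nat.max (bound p) (bound q)
  | All p => pred (bound p)
  end.

Definition closure (p : form) : form := Nat.iter (bound p) All p.

(** * Formulas with named bound variables

    A [body] is a formula waiting for the number [n] of enclosing quantifiers.
    A bound variable is represented by its level (the number of quantifiers
    enclosing its binder), so that it can be passed unchanged under further
    quantifiers; under [n] quantifiers, level [x] is the index [n - S x]. *)

Definition var := nat.
Definition body := nat -> form.

Definition b_eq (x y : var) : body := fun n => Eq (n - S x) (n - S y).
Definition b_mem (x y : var) : body := fun n => Mem (n - S x) (n - S y).
Definition b_neg (p : body) : body := fun n => Neg (p n).
Definition b_imp (p q : body) : body := fun n => Imp (p n) (q n).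
Definition b_and (p q : body) : body := fun n => And (p n) (q n).
Definition b_or (p q : body) : body := fun n => Or (p n) (q n).
Definition b_iff (p q : body) : body := fun n => Iff (p n) (q n).
Definition b_all (p : var -> body) : body := fun n => All (p n (S n)).
Definition b_ex (p : var -> body) : body := fun n => Ex (p n (S n)).

Definition sentence (p : body) : form := p 0.

(** [b_app1 p x] is p(x) and [b_app2 p x y] is p(x,y): the first free
    variables of [p] are the arguments, the remaining ones are parameters, left
    free outside the [n] enclosing quantifiers. *)
Definition b_app1 (p : form) (x : var) : body := fun n =>
  ren (fun k => match k with 0 => n - S x | S k => n + k end) p.
Definition b_app2 (p : form) (x y : var) : body := fun n =>
  ren (fun k => match k with 0 => n - S x | 1 => n - S y | S (S k) => n + k end) p.

Declare Scope zf_scope.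
Delimit Scope zf_scope with zf.
Bind Scope zf_scope with body.
Notation "x = y" := (b_eq x y) : zf_scope.
Notation "x ∈ y" := (b_mem x y) (at level 70, no associativity) : zf_scope.
Notation "~ p" := (b_neg p) : zf_scope.
Notation "p -> q" := (b_imp p q) : zf_scope.
Notation "p /\ q" := (b_and p q) : zf_scope.
Notation "p \/ q" := (b_or p q) : zf_scope.
Notation "p <-> q" := (b_iff p q) : zf_scope.
Notation "∀ x .. y , p" := (b_all (fun x => .. (b_all (fun y => p%zf)) ..))
  (at level 200, x binder, y binder, right associativity) : zf_scope.
Notation "∃ x .. y , p" := (b_ex (fun x => .. (b_ex (fun y => p%zf)) ..))
  (at level 200, x binder, y binder, right associativity) : zf_scope.
Local Open Scope zf_scope.

(** * Set-theoretic vocabulary *)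

Definition is_empty (x : var) : body := ∀ z, ~ z ∈ x.
Definition nonempty (x : var) : body := ∃ z, z ∈ x.
Definition subset (x y : var) : body := ∀ z, z ∈ x -> z ∈ y.

(** p = {a, b} *)
Definition is_upair (p a b : var) : body := ∀ z, z ∈ p <-> z = a \/ z = b.

(** p = {{a}, {a, b}} *)
Definition is_opair (p a b : var) : body :=
  ∃ u v, is_upair u a a /\ is_upair v a b /\ is_upair p u v.

(** (a, b) ∈ r *)
Definition related (r a b : var) : body := ∃ p, is_opair p a b /\ p ∈ r.

(** u = ⋃ x *)
Definition is_union (u x : var) : body := ∀ z, z ∈ u <-> ∃ y, y ∈ x /\ z ∈ y.

(** y = x ∪ {x} *)
Definition is_succ (y x : var) : body := ∀ z, z ∈ y <-> z ∈ x \/ z = x.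

Definition inductive (w : var) : body :=
  (∃ e, is_empty e /\ e ∈ w) /\
  (∀ x, x ∈ w -> ∃ y, is_succ y x /\ y ∈ w).

(** w = ω *)
Definition is_omega (w : var) : body :=
  inductive w /\ ∀ v, inductive v -> subset w v.

(** r ⊆ a × b *)
Definition is_relation (r a b : var) : body :=
  ∀ p, p ∈ r -> ∃ x y, x ∈ a /\ y ∈ b /\ is_opair p x y.

(** f : a → b *)
Definition is_function (f a b : var) : body :=
  is_relation f a b /\
  ∀ x, x ∈ a -> ∃ y, related f x y /\ ∀ y', related f x y' -> y' = y.

Definition is_injection (f a b : var) : body :=
  is_function f a b /\
  ∀ x x' y, related f x y -> related f x' y -> x = x'.

(** Finite (possibly empty) or countably infinite. *)
Definition countable (x : var) : body :=
  ∃ w f, is_omega w /\ is_injection f x w.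

(** * The theory ZF *)

Definition extensionality : body := ∀ x y, (∀ z, z ∈ x <-> z ∈ y) -> x = y.
Definition foundation : body :=
  ∀ x, nonempty x -> ∃ y, y ∈ x /\ ~ (∃ z, z ∈ x /\ z ∈ y).
Definition pairing : body := ∀ a b, ∃ p, is_upair p a b.
Definition union : body := ∀ x, ∃ u, is_union u x.
Definition power_set : body := ∀ x, ∃ y, ∀ z, z ∈ y <-> subset z x.
Definition infinity : body := ∃ w, inductive w.

Definition separation (p : form) : body :=
  ∀ a, ∃ b, ∀ x, x ∈ b <-> x ∈ a /\ b_app1 p x.

Definition replacement (p : form) : body :=
  (∀ x y y', b_app2 p x y -> b_app2 p x y' -> y = y') ->
  ∀ a, ∃ b, ∀ y, y ∈ b <-> ∃ x, x ∈ a /\ b_app2 p x y.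

Inductive ZF : form -> Prop :=
| ZF_extensionality : ZF (sentence extensionality)
| ZF_foundation : ZF (sentence foundation)
| ZF_pairing : ZF (sentence pairing)
| ZF_union : ZF (sentence union)
| ZF_power_set : ZF (sentence power_set)
| ZF_infinity : ZF (sentence infinity)
| ZF_separation p : ZF (closure (sentence (separation p)))
| ZF_replacement p : ZF (closure (sentence (replacement p))).

(** * Countable choice *)

(** [X] is the enumeration n ↦ X_n of the family, [F] = {X_n : n ∈ ω} and [U]
    is its union. *)
Definition AC_omega : form := sentence (
  ∀ w F X U,
    is_omega w ->
    is_function X w F ->
    (∀ x, x ∈ F -> ∃ n, n ∈ w /\ related X n x) ->
    (∀ n x, n ∈ w -> related X n x -> nonempty x) ->
    is_union U F ->
    ∃ f, is_function f F U /\
      ∀ n x y, n ∈ w -> related X n x -> related f x y -> y ∈ x).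

(** * Kolmogorov and Veloso problems

    A problem (I, S, σ) is given by its three components; [related σ z s] is
    "s solves z". *)

Definition kolmogorov_problem (I S σ : var) : body := is_relation σ I S.

Definition viable (I S σ : var) : body :=
  ∀ z, z ∈ I -> ∃ s, s ∈ S /\ related σ z s.

Definition non_generic (I S σ : var) : body :=
  ∀ s, s ∈ S -> ∃ z, z ∈ I /\ ~ related σ z s.

Definition veloso_problem (I S σ : var) : body :=
  kolmogorov_problem I S σ /\ nonempty I /\ nonempty S /\
  viable I S σ /\ non_generic I S σ.

Definition solution_function (f I S σ : var) : body :=
  is_function f I S /\ subset f σ.

Definition countable_veloso_solvable : form := sentence (
  ∀ I S σ, veloso_problem I S σ -> countable I ->
    ∃ f, solution_function f I S σ).

(* Main.v *)
Require Import Defs.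
From Stdlib Require Import List Arith Lia Cantor.
From Stdlib Require Import Classical ProofIrrelevance.
From Stdlib Require Import FunctionalExtensionality PropExtensionality.
Import ListNotations.

(** By the completeness theorem it is enough to prove the equivalence in every
    structure that satisfies the axioms of ZF, where one can argue as with
    ordinary sets, with classical logic and Leibniz equality ([completeness]).
    The structure for completeness is built from a consistent theory by
    Henkin's method: variables serve as the witnesses, which is possible because
    axioms are closed and so leave all variables unused. Sets are obtained in a
    model by separation. The formulas that separation needs are written with the
    same named bound variables as the axioms, and are matched with the
    propositions they express connective by connective ([expresses]).

    Choice gives solutions ([choice_solves]). Let (I, S, σ) be viable and let
    g : I → ω be injective. To each n attach the set of the s in S that solve
    every instance z with g(z) = n. This set is nonempty: if n = g(z), then z is
    the only such instance and viability applies; if n is not a value of g, the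
    set is all of S, which is nonempty. A choice function f for this family gives
    the solution z ↦ f(X_{g(z)}).

    Solutions give choice ([solutions_choose]). Let F = {X_n : n ∈ ω} consist of
    nonempty sets and let U be its union. In the problem (F, U, ∋) a point solves
    a set if it belongs to it, so a solution function is a choice function. The
    problem is viable. If it is generic, some point lies in every member of F,
    and a constant function chooses. Otherwise it is a Veloso problem, and F is
    countable because each member has a least index ([enumerated_countable]);
    that least indices exist comes from foundation, and that they are unique
    from the trichotomy of ω ([omega_trichotomy]). *)

(** * Renaming of variables *)

Definition scons {A : Type} (d : A) (e : nat -> A) (k : nat) : A :=
  match k with 0 => d | S k => e k end.

Lemma ren_ext_bound p : forall r s,
  (forall k, k < bound p -> r k = s k) -> ren r p = ren s p.
Proof.
  induction p as [|x y|x y|p IHp q IHq|p IHp]; cbn; intros r s H.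
  - reflexivity.
  - rewrite !H by lia; reflexivity.
  - rewrite !H by lia; reflexivity.
  - f_equal; [apply IHp | apply IHq]; intros k Hk; apply H; lia.
  - f_equal; apply IHp; intros [|k] Hk; cbn; [reflexivity|].
    rewrite H by lia; reflexivity.
Qed.

Lemma ren_ext p r s : (forall k, r k = s k) -> ren r p = ren s p.
Proof. intros H; apply ren_ext_bound; auto. Qed.

Lemma ren_id_bound p : forall r, (forall k, k < bound p -> r k = k) -> ren r p = p.
Proof.
  induction p as [|x y|x y|p IHp q IHq|p IHp]; cbn; intros r H.
  - reflexivity.
  - rewrite !H by lia; reflexivity.
  - rewrite !H by lia; reflexivity.
  - f_equal; [apply IHp | apply IHq]; intros k Hk; apply H; lia.
  - f_equal; apply IHp; intros [|k] Hk; cbn; [reflexivity|].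
    rewrite H by lia; reflexivity.
Qed.

Lemma ren_ren p : forall r s, ren r (ren s p) = ren (fun k => r (s k)) p.
Proof.
  induction p as [|x y|x y|p IHp q IHq|p IHp]; cbn; intros r s; f_equal; auto.
  rewrite IHp; apply ren_ext; intros [|k]; reflexivity.
Qed.

Lemma ren_inst r t p : ren r (inst t p) = inst (r t) (ren (up r) p).
Proof.
  unfold inst; rewrite !ren_ren; apply ren_ext; intros [|k]; reflexivity.
Qed.

Lemma bound_ren p : forall r m,
  (forall k, k < bound p -> r k < m) -> bound (ren r p) <= m.
Proof.
  induction p as [|x y|x y|p IHp q IHq|p IHp]; intros r m H; cbn in *.
  - lia.
  - pose proof (H x); pose proof (H y); lia.
  - pose proof (H x); pose proof (H y); lia.
  - assert (bound (ren r p) <= m) by (apply IHp; intros; apply H; lia).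
    assert (bound (ren r q) <= m) by (apply IHq; intros; apply H; lia). lia.
  - assert (bound (ren (up r) p) <= S m); [|lia].
    apply IHp; intros [|k] Hk; cbn; [lia|].
    assert (r k < m) by (apply H; lia); lia.
Qed.

(** * Derivations *)

Lemma prv_weaken G p : prv G p -> forall H, incl G H -> prv H p.
Proof.
  induction 1 as [G p Hp|G p q _ IH|G p q _ IH1 _ IH2|G p _ IH|G p _ IH|G p t _ IH
                 |G x|G p x y _ IH1 _ IH2]; intros H HGH.
  - apply prv_ctx; auto.
  - apply prv_impI, IH; intros a [<-|Ha]; [left | right]; auto.
  - eapply prv_impE; eauto.
  - apply prv_raa, IH; intros a [<-|Ha]; [left | right]; auto.
  - apply prv_allI, IH, incl_map, HGH.
  - apply prv_allE; auto.
  - apply prv_eq_refl.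
  - eapply prv_eq_subst; eauto.
Qed.

Lemma prv_ren G p : prv G p -> forall r, prv (map (ren r) G) (ren r p).
Proof.
  induction 1 as [G p Hp|G p q _ IH|G p q _ IH1 _ IH2|G p _ IH|G p _ IH|G p t _ IH
                 |G x|G p x y _ IH1 _ IH2]; intros r; cbn in *.
  - apply prv_ctx, in_map, Hp.
  - apply prv_impI, IH.
  - eapply prv_impE; [apply IH1 | apply IH2].
  - apply prv_raa, IH.
  - apply prv_allI. specialize (IH (up r)).
    rewrite map_map in IH |- *.
    erewrite map_ext; [exact IH|].
    intros q; rewrite !ren_ren; reflexivity.
  - rewrite ren_inst; apply prv_allE, IH.
  - apply prv_eq_refl.
  - rewrite ren_inst; eapply prv_eq_subst; [apply IH1|].
    rewrite <- ren_inst; apply IH2.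
Qed.

(** A variable that occurs nowhere else is as good as a bound one: the renaming
    that sends [c] to index 0 and shifts all others turns [inst c p] back into
    [p]. *)
Lemma prv_generalize G p c :
  (forall q, In q G -> bound q <= c) -> bound p <= S c ->
  prv G (inst c p) -> prv G (All p).
Proof.
  intros HG Hp H; apply prv_allI.
  set (r := fun k => if Nat.eqb k c then 0 else S k).
  apply prv_ren with (r := r) in H.
  replace (ren r (inst c p)) with p in H.
  - erewrite map_ext_in; [exact H|].
    intros q Hq; apply ren_ext_bound; intros k Hk; unfold r.
    specialize (HG q Hq). destruct (Nat.eqb_spec k c); lia.
  - symmetry; unfold inst; rewrite ren_ren; apply ren_id_bound.
    intros [|k] Hk; unfold r.
    + rewrite Nat.eqb_refl; reflexivity.
    + destruct (Nat.eqb_spec k c); lia.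
Qed.

(** * Theories *)

Definition adjoin (T : form -> Prop) (p q : form) : Prop := q = p \/ T q.
Definition consistent (T : form -> Prop) : Prop := ~ provable T Fal.

Lemma provable_mono (T U : form -> Prop) p :
  (forall q, T q -> U q) -> provable T p -> provable U p.
Proof. intros H (G & HG & HGp); exists G; auto. Qed.

Lemma provable_axiom (T : form -> Prop) p : T p -> provable T p.
Proof.
  intros H; exists [p]; split.
  - intros q [<-|[]]; exact H.
  - apply prv_ctx; left; reflexivity.
Qed.

Lemma provable_refl T x : provable T (Eq x x).
Proof. exists []; split; [intros q [] | apply prv_eq_refl]. Qed.

Lemma provable_mp T p q : provable T (Imp p q) -> provable T p -> provable T q.
Proof.
  intros (G & HG & HGp) (H & HH & HHp); exists (G ++ H); split.
  - intros a Ha; apply in_app_or in Ha as []; auto.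
  - eapply prv_impE; eapply prv_weaken; eauto using incl_appl, incl_appr, incl_refl.
Qed.

Lemma provable_subst T p x y :
  provable T (Eq x y) -> provable T (inst x p) -> provable T (inst y p).
Proof.
  intros (G & HG & HGp) (H & HH & HHp); exists (G ++ H); split.
  - intros a Ha; apply in_app_or in Ha as []; auto.
  - eapply prv_eq_subst; eapply prv_weaken; eauto using incl_appl, incl_appr, incl_refl.
Qed.

Lemma provable_inst T p t : provable T (All p) -> provable T (inst t p).
Proof. intros (G & HG & HGp); exists G; split; [exact HG | apply prv_allE, HGp]. Qed.

(** A context from [adjoin T p] is a context from [T] together with [p]; this
    turns the rules for lists of hypotheses into rules for theories. *)
Lemma adjoin_context T p G :
  (forall q, In q G -> adjoin T p q) ->
  exists H, (forall q, In q H -> T q) /\ incl G (p :: H).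
Proof.
  induction G as [|a G IH]; intros HG.
  - exists []; split; [intros q [] | intros q []].
  - destruct IH as (H & HH & Hincl); [intros; apply HG; right; auto|].
    destruct (HG a (or_introl eq_refl)) as [->|Ha].
    + exists H; split; [exact HH|]. intros q [<-|Hq]; [left|]; auto.
    + exists (a :: H); split; [intros q [<-|Hq]; auto|].
      intros q [<-|Hq]; [right; left; reflexivity|].
      destruct (Hincl q Hq) as [<-|]; [left | right; right]; auto.
Qed.

Lemma provable_deduction T p q : provable (adjoin T p) q -> provable T (Imp p q).
Proof.
  intros (G & HG & HGq); destruct (adjoin_context _ _ _ HG) as (H & HH & Hincl).
  exists H; split; [exact HH|]. apply prv_impI; eapply prv_weaken; eauto.
Qed.

Lemma provable_raa T p : provable (adjoin T (Neg p)) Fal -> provable T p.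
Proof.
  intros (G & HG & HGq); destruct (adjoin_context _ _ _ HG) as (H & HH & Hincl).
  exists H; split; [exact HH|]. apply prv_raa; eapply prv_weaken; eauto.
Qed.

Lemma provable_explosion T p : provable T Fal -> provable T p.
Proof.
  intros H; apply provable_raa; eapply provable_mono; [|exact H].
  intros q Hq; right; exact Hq.
Qed.

(** * Enumeration of the formulas *)

(** A code is a Cantor pair of a tag and the data of the formula. The recursion is
    on [fuel], a bound on the depth of the formula. *)
Fixpoint decode (fuel n : nat) : form :=
  match fuel with
  | 0 => Fal
  | S fuel =>
      let (tag, m) := of_nat n in
      let (a, b) := of_nat m in
      match tag with
      | 0 => Fal
      | 1 => Eq a b
      | 2 => Mem a b
      | 3 => Imp (decode fuel a) (decode fuel b)
      | _ => All (decode fuel a)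
      end
  end.

Lemma decode_surjective p :
  exists d, forall fuel, d <= fuel -> exists n, decode fuel n = p.
Proof.
  (* The claim covers all large enough values of fuel so that the two sides of an
     implication can be decoded with the same one. *)
  induction p as [|x y|x y|p [d IHp] q [d' IHq]|p [d IHp]].
  - exists 1; intros [|fuel] H; [lia|].
    exists (to_nat (0, to_nat (0, 0))); cbn [decode].
    rewrite !cancel_of_to; reflexivity.
  - exists 1; intros [|fuel] H; [lia|].
    exists (to_nat (1, to_nat (x, y))); cbn [decode].
    rewrite !cancel_of_to; reflexivity.
  - exists 1; intros [|fuel] H; [lia|].
    exists (to_nat (2, to_nat (x, y))); cbn [decode].
    rewrite !cancel_of_to; reflexivity.
  - exists (S (Nat.max d d')); intros [|fuel] H; [lia|].
    destruct (IHp fuel) as [a <-]; [lia|]. destruct (IHq fuel) as [b <-]; [lia|].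
    exists (to_nat (3, to_nat (a, b))); cbn [decode].
    rewrite !cancel_of_to; reflexivity.
  - exists (S d); intros [|fuel] H; [lia|].
    destruct (IHp fuel) as [a <-]; [lia|].
    exists (to_nat (4, to_nat (a, 0))); cbn [decode].
    rewrite !cancel_of_to; reflexivity.
Qed.

Definition enum_form (n : nat) : form := let (fuel, m) := of_nat n in decode fuel m.

Lemma enum_form_surjective p : exists n, enum_form n = p.
Proof.
  destruct (decode_surjective p) as [d H]; destruct (H d (le_n d)) as [n Hn].
  exists (to_nat (d, n)); unfold enum_form; rewrite cancel_of_to; exact Hn.
Qed.

(** * Henkin extensions *)

(** The maximal consistent theories whose universal formulas have a
    counterexample among the variables as soon as they fail. *)
Record henkin (W : form -> Prop) : Prop := {
  henkin_consistent : consistent W;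
  henkin_closed : forall p, provable W p -> W p;
  henkin_complete : forall p, W p \/ W (Neg p);
  henkin_witness : forall p, (forall t, W (inst t p)) -> W (All p)
}.

Section HenkinExtension.

Variables (T : form -> Prop) (c0 : nat).
Hypothesis T_bounded : forall q, T q -> bound q <= c0.
Hypothesis T_consistent : consistent T.

(** Consistent formulas are added. A refuted universal formula gets the variable
    [c] as its counterexample. The definition is by cases inside a proposition
    because consistency is undecidable. *)
Definition extend (c : nat) (p : form) (U : form -> Prop) (q : form) : Prop :=
  U q \/
  (consistent (adjoin U p) /\ q = p) \/
  (~ consistent (adjoin U p) /\ exists p', p = All p' /\ q = Neg (inst c p')).

(** A bound on the free variables of [stage n]. It grows at each stage to cover
    both the formula under consideration and its witness. *)
Fixpoint fresh (n : nat) : nat :=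
  match n with
  | 0 => c0
  | S n => S (Nat.max (fresh n) (bound (enum_form n)))
  end.

Definition witness (n : nat) : nat := Nat.max (fresh n) (bound (enum_form n)).

Fixpoint stage (n : nat) : form -> Prop :=
  match n with
  | 0 => T
  | S n => extend (witness n) (enum_form n) (stage n)
  end.

Lemma stage_bounded n : forall q, stage n q -> bound q <= fresh n.
Proof.
  induction n as [|n IH]; cbn; [exact T_bounded|].
  intros q [Hq|[[_ ->]|(_ & p & Hp & ->)]].
  - specialize (IH q Hq); lia.
  - lia.
  - cbn. rewrite Nat.max_0_r. apply bound_ren. unfold witness.
    rewrite Hp; cbn. intros [|k] Hk; lia.
Qed.

(** The witness is the critical case: if the negated instance at a fresh variable
    were inconsistent, the instance would be provable, hence so would be the
    universal formula, which is refuted. *)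
Lemma stage_consistent n : consistent (stage n).
Proof.
  induction n as [|n IH]; cbn; [exact T_consistent|].
  set (p := enum_form n) in *.
  destruct (classic (consistent (adjoin (stage n) p))) as [Hc|Hc]; intros H.
  - apply Hc; eapply provable_mono; [|exact H].
    intros q [Hq|[[_ ->]|[Hq _]]]; [right; exact Hq | left; reflexivity | contradiction].
  - assert (Hp : ~ provable (stage n) p).
    { intros Hp; apply Hc; intros Hf; apply IH.
      eapply provable_mp; [apply provable_deduction, Hf | exact Hp]. }
    destruct (classic (exists p', p = All p')) as [[p' Hp']|Hall].
    + apply Hp; rewrite Hp'.
      assert (Hi : provable (stage n) (inst (witness n) p')).
      { apply provable_raa; eapply provable_mono; [|exact H].
        intros q [Hq|[[Hq _]|(_ & p'' & Hp'' & ->)]]; [right; exact Hq | contradiction|].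
        left; rewrite Hp' in Hp''; injection Hp'' as <-; reflexivity. }
      destruct Hi as (G & HG & HGp); exists G; split; [exact HG|].
      apply prv_generalize with (witness n); [| |exact HGp]; unfold witness.
      * intros q Hq; specialize (stage_bounded n q (HG q Hq)); lia.
      * fold p; rewrite Hp'; cbn; lia.
    + apply IH; eapply provable_mono; [|exact H].
      intros q [Hq|[[Hq _]|(_ & p' & Hp' & _)]]; [exact Hq | contradiction|].
      exfalso; eauto.
Qed.

Lemma stage_mono m n q : m <= n -> stage m q -> stage n q.
Proof. induction 1 as [|n _ IH]; [auto | intros H; left; auto]. Qed.

Definition stages (q : form) : Prop := exists n, stage n q.

Lemma stages_finite G : (forall q, In q G -> stages q) ->
  exists n, forall q, In q G -> stage n q.
Proof.
  induction G as [|a G IH]; intros HG; [exists 0; intros q []|].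
  destruct IH as [n Hn]; [intros; apply HG; right; auto|].
  destruct (HG a (or_introl eq_refl)) as [m Hm].
  exists (Nat.max m n); intros q [<-|Hq].
  - apply stage_mono with m; [lia | exact Hm].
  - apply stage_mono with n; [lia | auto].
Qed.

Lemma stages_consistent : consistent stages.
Proof.
  intros (G & HG & HGf); destruct (stages_finite G HG) as [n Hn].
  apply (stage_consistent n); exists G; auto.
Qed.

(** [p] is decided at the stage that considers it, and what is inconsistent there
    stays so. *)
Lemma stages_decide p : stages p \/ provable stages (Neg p).
Proof.
  destruct (enum_form_surjective p) as [n <-].
  destruct (classic (consistent (adjoin (stage n) (enum_form n)))) as [Hc|Hc].
  - left; exists (S n); right; left; auto.
  - right; apply NNPP in Hc; apply provable_deduction in Hc.
    eapply provable_mono; [|exact Hc]. intros q Hq; exists n; exact Hq.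
Qed.

Lemma stages_closed p : provable stages p -> stages p.
Proof.
  intros Hp; destruct (stages_decide p) as [H|H]; [exact H|].
  exfalso; apply stages_consistent; eapply provable_mp; eauto.
Qed.

Lemma henkin_stages : henkin stages.
Proof.
  split.
  - exact stages_consistent.
  - exact stages_closed.
  - intros p; destruct (stages_decide p); [left | right; apply stages_closed]; auto.
  - intros p Hp; destruct (enum_form_surjective (All p)) as [n Hn].
    destruct (classic (consistent (adjoin (stage n) (All p)))) as [Hc|Hc].
    + exists (S n); right; left; rewrite Hn; auto.
    + exfalso; apply stages_consistent.
      eapply provable_mp; apply provable_axiom; [|exact (Hp (witness n))].
      exists (S n); right; right; rewrite Hn; eauto.
Qed.

End HenkinExtension.

Lemma henkin_extension T c :
  (forall q, T q -> bound q <= c) -> consistent T ->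
  exists W, henkin W /\ forall q, T q -> W q.
Proof.
  intros Hb Hc; exists (stages T c); split; [apply henkin_stages; assumption|].
  intros q Hq; exists 0; exact Hq.
Qed.

(** * Structures and satisfaction *)

Record structure : Type := { carrier :> Type; mem : carrier -> carrier -> Prop }.
Arguments mem {_} _ _.

Fixpoint sat {M : structure} (e : nat -> M) (p : form) : Prop :=
  match p with
  | Fal => False
  | Eq x y => e x = e y
  | Mem x y => mem (e x) (e y)
  | Imp p q => sat e p -> sat e q
  | All p => forall d, sat (scons d e) p
  end.

Lemma sat_ext_bound {M : structure} p : forall e e' : nat -> M,
  (forall k, k < bound p -> e k = e' k) -> sat e p <-> sat e' p.
Proof.
  induction p as [|x y|x y|p IHp q IHq|p IHp]; cbn; intros e e' H.
  - reflexivity.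
  - rewrite !H by lia; reflexivity.
  - rewrite !H by lia; reflexivity.
  - rewrite (IHp e e'), (IHq e e'); [reflexivity| |]; intros k Hk; apply H; lia.
  - assert (Hd : forall d, sat (scons d e) p <-> sat (scons d e') p).
    { intros d; apply IHp; intros [|k] Hk; cbn; [reflexivity | apply H; lia]. }
    split; intros Hs d; apply Hd, Hs.
Qed.

Lemma sat_ext {M : structure} p (e e' : nat -> M) :
  (forall k, e k = e' k) -> sat e p <-> sat e' p.
Proof. intros H; apply sat_ext_bound; auto. Qed.

Lemma sat_ren {M : structure} p : forall r (e : nat -> M),
  sat e (ren r p) <-> sat (fun k => e (r k)) p.
Proof.
  induction p as [|x y|x y|p IHp q IHq|p IHp]; cbn; intros r e; try reflexivity.
  - rewrite IHp, IHq; reflexivity.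
  - assert (Hd : forall d, sat (scons d e) (ren (up r) p) <->
                           sat (scons d (fun k => e (r k))) p).
    { intros d; rewrite IHp; apply sat_ext; intros [|k]; reflexivity. }
    split; intros Hs d; apply Hd, Hs.
Qed.

Definition models (M : structure) (T : form -> Prop) : Prop :=
  forall q, T q -> forall e : nat -> M, sat e q.

(** * The completeness theorem *)

Section TermModel.

Variable W : form -> Prop.
Hypothesis HW : henkin W.

Lemma henkin_provable p : provable W p <-> W p.
Proof. split; [apply henkin_closed, HW | apply provable_axiom]. Qed.

Lemma henkin_refl x : W (Eq x x).
Proof. apply henkin_provable, provable_refl. Qed.

Lemma henkin_subst p x y : W (Eq x y) -> W (inst x p) -> W (inst y p).
Proof. rewrite <- !henkin_provable; apply provable_subst. Qed.

Lemma henkin_sym x y : W (Eq x y) -> W (Eq y x).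
Proof. intros H; apply (henkin_subst (Eq 0 (S x)) x y H), henkin_refl. Qed.

Lemma henkin_trans x y z : W (Eq x y) -> W (Eq y z) -> W (Eq x z).
Proof. intros H H'; exact (henkin_subst (Eq (S x) 0) y z H' H). Qed.

Lemma henkin_mem x x' y y' : W (Eq x x') -> W (Eq y y') -> W (Mem x y) -> W (Mem x' y').
Proof.
  intros Hx Hy H; apply (henkin_subst (Mem (S x') 0) y y' Hy).
  exact (henkin_subst (Mem 0 (S y)) x x' Hx H).
Qed.

(** The points are the classes of provably equal variables, so that equality of
    points is Leibniz equality. *)
Definition term_class (k : nat) : nat -> Prop := fun j => W (Eq k j).
Definition point : Type := { P : nat -> Prop | exists k, P = term_class k }.
Definition pt (k : nat) : point :=
  exist _ (term_class k) (ex_intro _ k eq_refl).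

Definition term_model : structure :=
  {| carrier := point;
     mem a b := exists k j, a = pt k /\ b = pt j /\ W (Mem k j) |}.

Lemma pt_eq k j : pt k = pt j <-> W (Eq k j).
Proof.
  split; intros H.
  - apply (f_equal (@proj1_sig _ _)) in H; cbn in H.
    change (term_class k j); rewrite H; apply henkin_refl.
  - apply subset_eq_compat, functional_extensionality; intros i.
    apply propositional_extensionality; split; intros Hi.
    + exact (henkin_trans _ _ _ (henkin_sym _ _ H) Hi).
    + exact (henkin_trans _ _ _ H Hi).
Qed.

Lemma pt_surjective (a : point) : exists k, a = pt k.
Proof.
  destruct a as [P [k ->]]; exists k; apply subset_eq_compat; reflexivity.
Qed.

(** The renaming [r] makes structural induction possible: under a quantifier the
    point chosen for the bound variable becomes part of the renaming. *)
Lemma truth_lemma p : forall r, @sat term_model (fun k => pt (r k)) p <-> W (ren r p).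
Proof.
  induction p as [|x y|x y|p IHp q IHq|p IHp]; intros r; cbn.
  - split; [intros []|]. intros H; apply (henkin_consistent _ HW), provable_axiom, H.
  - apply pt_eq.
  - split.
    + intros (k & j & Hk & Hj & H); apply pt_eq in Hk, Hj.
      apply henkin_mem with k j; auto using henkin_sym.
    + intros H; exists (r x), (r y); auto.
  - rewrite IHp, IHq; split; intros H.
    + destruct (henkin_complete _ HW (ren r p)) as [Hp|Hp].
      * specialize (H Hp); apply henkin_provable, provable_deduction.
        apply provable_axiom; right; exact H.
      * apply henkin_provable, provable_deduction, provable_explosion.
        eapply provable_mp; apply provable_axiom; [right; exact Hp | left; reflexivity].
    + intros Hp; apply henkin_provable.
      eapply provable_mp; apply provable_axiom; eauto.
  - assert (Hd : forall t, @sat term_model (scons (pt t) (fun k => pt (r k))) p <->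
                           W (inst t (ren (up r) p))).
    { intros t; unfold inst; rewrite ren_ren, <- IHp.
      apply sat_ext; intros [|k]; reflexivity. }
    split; intros H.
    + apply (henkin_witness _ HW); intros t; apply Hd, H.
    + intros d; destruct (pt_surjective d) as [t ->].
      apply Hd, henkin_provable, provable_inst, henkin_provable, H.
Qed.

End TermModel.

(** If [p] is not provable, then [T] with the negation of [p] extends to a Henkin
    theory, whose term model satisfies [T] and not [p]. *)
Theorem completeness T p :
  (forall q, T q -> bound q = 0) ->
  (forall M : structure, models M T -> forall e : nat -> M, sat e p) ->
  provable T p.
Proof.
  intros HT H; apply provable_raa; apply NNPP; intros Hc.
  destruct (henkin_extension (adjoin T (Neg p)) (bound (Neg p))) as (W & HW & HTW).
  - intros q [->|Hq]; [lia | rewrite (HT q Hq); lia].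
  - exact Hc.
  - assert (Hp : @sat (term_model W) (pt W) (Neg p)).
    { apply (truth_lemma W HW (Neg p) (fun k => k)); rewrite ren_id_bound by auto.
      apply HTW; left; reflexivity. }
    apply Hp, H; intros q Hq e.
    apply (@sat_ext_bound (term_model W) q e (fun k => pt W k)); [rewrite (HT q Hq); lia|].
    apply (truth_lemma W HW q (fun k => k)); rewrite ren_id_bound by auto.
    apply HTW; right; exact Hq.
Qed.

(** * Reading bodies in a structure *)

(** Under [n] quantifiers, the named variable [x] is read at the index [n - S x];
    the condition [x < n] excludes the free variables, for which truncated
    subtraction would give a meaningless index. *)
Definition at_level {M : structure} (n : nat) (e : nat -> M) (x : var) (a : M) : Prop :=
  x < n /\ e (n - S x) = a.

Definition expresses {M : structure} (n : nat) (e : nat -> M) (b : body) (P : Prop) : Prop :=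
  sat e (b n) <-> P.

Section Reading.

Context {M : structure}.
Implicit Types (e : nat -> M) (a : M) (p q : body) (P Q : Prop).

Lemma at_level_top n e a : at_level (S n) (scons a e) n a.
Proof. split; [lia|]. replace (S n - S n) with 0 by lia; reflexivity. Qed.

Lemma at_level_under n e d x a : at_level n e x a -> at_level (S n) (scons d e) x a.
Proof.
  intros [Hx <-]; split; [lia|].
  replace (S n - S x) with (S (n - S x)) by lia; reflexivity.
Qed.

Lemma expresses_eq n e x y a a' :
  at_level n e x a -> at_level n e y a' -> expresses n e (x = y) (a = a').
Proof. intros [_ <-] [_ <-]; apply iff_refl. Qed.

Lemma expresses_mem n e x y a a' :
  at_level n e x a -> at_level n e y a' -> expresses n e (b_mem x y) (mem a a').
Proof. intros [_ <-] [_ <-]; apply iff_refl. Qed.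

Lemma expresses_neg n e p P : expresses n e p P -> expresses n e (~ p) (~ P).
Proof. unfold expresses; cbn; tauto. Qed.

Lemma expresses_imp n e p q P Q :
  expresses n e p P -> expresses n e q Q -> expresses n e (p -> q) (P -> Q).
Proof. unfold expresses; cbn; tauto. Qed.

Lemma expresses_and n e p q P Q :
  expresses n e p P -> expresses n e q Q -> expresses n e (p /\ q) (P /\ Q).
Proof.
  unfold expresses; cbn; intros <- <-; destruct (classic (sat e (q n))); tauto.
Qed.

Lemma expresses_or n e p q P Q :
  expresses n e p P -> expresses n e q Q -> expresses n e (p \/ q) (P \/ Q).
Proof.
  unfold expresses; cbn; intros <- <-; destruct (classic (sat e (p n))); tauto.
Qed.

Lemma expresses_iff n e p q P Q :
  expresses n e p P -> expresses n e q Q -> expresses n e (p <-> q) (P <-> Q).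
Proof.
  intros HP HQ; apply (expresses_and n e (p -> q) (q -> p)); apply expresses_imp; assumption.
Qed.

Lemma expresses_all n e (p : var -> body) (P : M -> Prop) :
  (forall d, expresses (S n) (scons d e) (p n) (P d)) ->
  expresses n e (b_all p) (forall d, P d).
Proof. intros H; split; intros Hs d; apply H, Hs. Qed.

Lemma expresses_ex n e (p : var -> body) (P : M -> Prop) :
  (forall d, expresses (S n) (scons d e) (p n) (P d)) ->
  expresses n e (b_ex p) (exists d, P d).
Proof.
  intros H; unfold expresses; cbn; split.
  - intros Hs; apply NNPP; intros Hn; apply Hs; intros d Hd; apply Hn.
    exists d; apply H, Hd.
  - intros [d Hd] Hs; apply (Hs d), H, Hd.
Qed.

(** Parameters occupy the lowest levels, so that the numerals 0, 1, ... name them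
    under any number of further quantifiers. *)
Definition carries (n : nat) (e : nat -> M) (l : list M) : Prop :=
  forall i a, nth_error l i = Some a -> at_level n e i a.

Lemma at_level_carried n e l i a :
  carries n e l -> nth_error l i = Some a -> at_level n e i a.
Proof. intros H; apply H. Qed.

Lemma carries_under n e d l : carries n e l -> carries (S n) (scons d e) l.
Proof. intros H i a Hi; apply at_level_under, H, Hi. Qed.

Definition params (l : list M) (e : nat -> M) : nat -> M :=
  fold_left (fun e a => scons a e) l e.

Lemma carries_params l e : carries (length l) (params l e) l.
Proof.
  revert e; induction l as [|a l IH] using rev_ind; intros e i b Hi.
  - destruct i; discriminate.
  - unfold params; rewrite fold_left_app, length_app, Nat.add_1_r; cbn.
    destruct (Nat.lt_ge_cases i (length l)) as [Hl|Hl].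
    + rewrite nth_error_app1 in Hi by exact Hl. apply at_level_under, IH, Hi.
    + rewrite nth_error_app2 in Hi by exact Hl.
      destruct (i - length l) as [|j] eqn:Hj; [|destruct j; discriminate].
      injection Hi as <-. replace i with (length l) by lia. apply at_level_top.
Qed.

(** Definability from parameters. The body is asked to work under any number of
    quantifiers, so that a definable predicate can be used inside other bodies. *)
Definition definable (P : M -> Prop) : Prop :=
  exists (b : var -> body) (l : list M), forall n e x a,
    carries n e l -> at_level n e x a -> expresses n e (b x) (P a).

Definition definable2 (R : M -> M -> Prop) : Prop :=
  exists (b : var -> var -> body) (l : list M), forall n e x y a a',
    carries n e l -> at_level n e x a -> at_level n e y a' ->
    expresses n e (b x y) (R a a').

End Reading.

Ltac find_level :=
  solve [repeat first
    [ eassumption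
    | apply at_level_top
    | eapply at_level_carried; [eassumption | reflexivity]
    | apply at_level_under ]].

Ltac unfold_body b :=
  lazymatch b with
  | ?f _ => unfold_body f
  | _ => unfold b
  end.

(** Proves [expresses n e b P] by recursion on [b], unfolding the vocabulary in
    [b]; the proposition [P] is unfolded by unification as far as needed. *)
Ltac express :=
  cbn beta zeta;
  repeat lazymatch goal with
  | |- forall _, _ => intros ?
  | |- at_level _ _ _ _ => find_level
  | |- expresses _ _ (b_eq _ _) _ => apply expresses_eq
  | |- expresses _ _ (b_mem _ _) _ => apply expresses_mem
  | |- expresses _ _ (b_neg _) _ => apply expresses_neg
  | |- expresses _ _ (b_imp _ _) _ => apply expresses_imp
  | |- expresses _ _ (b_and _ _) _ => apply expresses_and
  | |- expresses _ _ (b_or _ _) _ => apply expresses_or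
  | |- expresses _ _ (b_iff _ _) _ => apply expresses_iff
  | |- expresses _ _ (b_all _) _ => apply expresses_all; cbn beta
  | |- expresses _ _ (b_ex _) _ => apply expresses_ex; cbn beta
  | |- expresses _ _ ?b _ => first [eassumption | unfold_body b]
  end.

(** * Set-theoretic vocabulary in a structure *)

Notation "x ∈ y" := (mem x y) (at level 70, no associativity) : type_scope.

Section Vocabulary.

Context {M : structure}.
Implicit Types a b f p r u v w x y z : M.

(** From here to [m_veloso_solvable], each definition is what the body of the
    corresponding name expresses. *)
Definition m_empty x := forall z, ~ z ∈ x.
Definition m_nonempty x := exists z, z ∈ x.
Definition m_subset x y := forall z, z ∈ x -> z ∈ y.
Definition m_upair p a b := forall z, z ∈ p <-> z = a \/ z = b.
Definition m_opair p a b := exists u v, m_upair u a a /\ m_upair v a b /\ m_upair p u v.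
Definition m_related r a b := exists p, m_opair p a b /\ p ∈ r.
Definition m_union u x := forall z, z ∈ u <-> exists y, y ∈ x /\ z ∈ y.
Definition m_succ y x := forall z, z ∈ y <-> z ∈ x \/ z = x.
Definition m_inductive w :=
  (exists e, m_empty e /\ e ∈ w) /\ (forall x, x ∈ w -> exists y, m_succ y x /\ y ∈ w).
Definition m_omega w := m_inductive w /\ forall v, m_inductive v -> m_subset w v.
Definition m_relation r a b :=
  forall p, p ∈ r -> exists x y, x ∈ a /\ y ∈ b /\ m_opair p x y.
Definition m_function f a b :=
  m_relation f a b /\
  forall x, x ∈ a -> exists y, m_related f x y /\ forall y', m_related f x y' -> y' = y.
Definition m_injection f a b :=
  m_function f a b /\ forall x x' y, m_related f x y -> m_related f x' y -> x = x'.
Definition m_countable x := exists w f, m_omega w /\ m_injection f x w.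

Definition m_choice : Prop := forall w F X U : M,
  m_omega w -> m_function X w F ->
  (forall x, x ∈ F -> exists n, n ∈ w /\ m_related X n x) ->
  (forall n x, n ∈ w -> m_related X n x -> m_nonempty x) ->
  m_union U F ->
  exists f, m_function f F U /\
    forall n x y, n ∈ w -> m_related X n x -> m_related f x y -> y ∈ x.

Definition m_viable (I S s : M) := forall z, z ∈ I -> exists t, t ∈ S /\ m_related s z t.
Definition m_non_generic (I S s : M) :=
  forall t, t ∈ S -> exists z, z ∈ I /\ ~ m_related s z t.
Definition m_veloso (I S s : M) :=
  m_relation s I S /\ m_nonempty I /\ m_nonempty S /\ m_viable I S s /\ m_non_generic I S s.

Definition m_veloso_solvable : Prop := forall I S s : M,
  m_veloso I S s -> m_countable I -> exists f, m_function f I S /\ m_subset f s.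

Lemma sat_sentence (e : nat -> M) (b : body) (P : Prop) :
  expresses 0 e b P -> sat e (sentence b) <-> P.
Proof. exact (fun H => H). Qed.

Lemma sat_AC_omega (e : nat -> M) : sat e AC_omega <-> m_choice.
Proof. apply sat_sentence; express. Qed.

Lemma sat_countable_veloso_solvable (e : nat -> M) :
  sat e countable_veloso_solvable <-> m_veloso_solvable.
Proof. apply sat_sentence; express. Qed.

End Vocabulary.

(** * Closures of axioms *)

Lemma bound_closure p : bound (closure p) = 0.
Proof.
  unfold closure. assert (H : forall n, bound (Nat.iter n All p) = bound p - n).
  { induction n as [|n IH]; [cbn; lia|]. rewrite Nat.iter_succ; cbn [bound]; lia. }
  rewrite H; lia.
Qed.

(** Stripping the [n] quantifiers lets the values of the first [n] variables be
    chosen freely, so any environment can be reached. *)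
Lemma sat_iter_all {M : structure} n p : forall e e' : nat -> M,
  (forall k, e' (n + k) = e k) -> sat e (Nat.iter n All p) -> sat e' p.
Proof.
  induction n as [|n IH]; cbn; intros e e' He.
  - apply sat_ext; exact He.
  - intros H; apply IH with (2 := H (e' n)).
    intros [|k]; cbn; [f_equal; lia|]. rewrite <- He; f_equal; lia.
Qed.

Lemma models_closure {M : structure} (T : form -> Prop) p (e : nat -> M) :
  models M T -> T (closure p) -> sat e p.
Proof.
  intros HM HT; apply (sat_iter_all (bound p)) with (fun k => e (bound p + k));
    [reflexivity | apply HM, HT].
Qed.

Lemma ZF_closed p : ZF p -> bound p = 0.
Proof. intros []; try reflexivity; apply bound_closure. Qed.

(** * Sets in a model of ZF *)

Section Model.

Context {M : structure}.
Hypothesis HM : models M ZF.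

(** Structures may be empty; the point [x] provides an environment. *)
Lemma ZF_read (x : M) (b : body) (P : Prop) :
  ZF (sentence b) -> (forall e : nat -> M, expresses 0 e b P) -> P.
Proof. intros Hb HP; apply (HP (fun _ => x)), HM, Hb. Qed.

Lemma set_ext (x y : M) : (forall z, z ∈ x <-> z ∈ y) -> x = y.
Proof.
  assert (H : forall x y : M, (forall z, z ∈ x <-> z ∈ y) -> x = y).
  { apply (ZF_read x _ _ ZF_extensionality); express. }
  exact (H x y).
Qed.

Lemma foundation_in (x : M) :
  m_nonempty x -> exists y, y ∈ x /\ ~ exists z, z ∈ x /\ z ∈ y.
Proof.
  assert (H : forall x : M,
    m_nonempty x -> exists y, y ∈ x /\ ~ exists z, z ∈ x /\ z ∈ y).
  { apply (ZF_read x _ _ ZF_foundation); express. }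
  exact (H x).
Qed.

Lemma pairing_in (a b : M) : exists p, m_upair p a b.
Proof.
  assert (H : forall a b : M, exists p, m_upair p a b).
  { apply (ZF_read a _ _ ZF_pairing); express. }
  exact (H a b).
Qed.

Lemma union_in (x : M) : exists u, m_union u x.
Proof.
  assert (H : forall x : M, exists u, m_union u x).
  { apply (ZF_read x _ _ ZF_union); express. }
  exact (H x).
Qed.

Lemma power_in (x : M) : exists y, forall z, z ∈ y <-> m_subset z x.
Proof.
  assert (H : forall x : M, exists y, forall z, z ∈ y <-> m_subset z x).
  { apply (ZF_read x _ _ ZF_power_set); express. }
  exact (H x).
Qed.

Lemma separation_in (P : M -> Prop) : definable P ->
  forall a, exists b, forall x, x ∈ b <-> x ∈ a /\ P x.
Proof.
  intros (b & l & Hb) a.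
  set (n := length l). set (e := params l (fun _ => a)).
  set (p := b n (S n)).
  (* The free variables of [p] above 0 are parameters, to be found outside the
     three quantifiers of the axiom, where the environment is [e]. *)
  assert (H : expresses 0 e (separation p)
    (forall a, exists b, forall x, x ∈ b <-> x ∈ a /\ P x)).
  { unfold separation; express. unfold b_app1, expresses.
    rewrite sat_ren. rewrite (sat_ext _ _ (scons d1 e)).
    - apply Hb; [apply carries_under, carries_params | apply at_level_top].
    - intros [|k]; reflexivity. }
  apply H. exact (models_closure ZF _ e HM (ZF_separation p)).
Qed.

(** ** Ordered pairs *)

Lemma upair_unique (p q a b : M) : m_upair p a b -> m_upair q a b -> p = q.
Proof. intros Hp Hq; apply set_ext; intros z; rewrite (Hp z), (Hq z); reflexivity. Qed.

Lemma opair_exists (a b : M) : exists p, m_opair p a b.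
Proof.
  destruct (pairing_in a a) as [u Hu], (pairing_in a b) as [v Hv].
  destruct (pairing_in u v) as [p Hp]; exists p, u, v; auto.
Qed.

Lemma opair_unique (p q a b : M) : m_opair p a b -> m_opair q a b -> p = q.
Proof.
  intros (u & v & Hu & Hv & Hp) (u' & v' & Hu' & Hv' & Hq).
  rewrite (upair_unique _ _ _ _ Hu' Hu), (upair_unique _ _ _ _ Hv' Hv) in Hq.
  exact (upair_unique _ _ _ _ Hp Hq).
Qed.

Lemma opair_injective (p a b a' b' : M) :
  m_opair p a b -> m_opair p a' b' -> a = a' /\ b = b'.
Proof.
  intros (u & v & Hu & Hv & Hp) (u' & v' & Hu' & Hv' & Hp').
  assert (Ha : a = a').
  { assert (H : u = u' \/ u = v') by (apply Hp', Hp; auto).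
    destruct H as [<-|<-].
    - assert (a = a' \/ a = a') by (apply Hu', Hu; auto). tauto.
    - assert (a' = a \/ a' = a) by (apply Hu, Hv'; auto). intuition congruence. }
  split; [exact Ha|]; subst a'.
  assert (H : v = u' \/ v = v') by (apply Hp', Hp; auto).
  assert (H' : v' = u \/ v' = v) by (apply Hp, Hp'; auto).
  assert (Hb : b ∈ v) by (apply Hv; auto).
  assert (Hb' : b' ∈ v') by (apply Hv'; auto).
  assert (b = a \/ b = b').
  { destruct H as [->| ->]; [apply Hu' in Hb; tauto | apply Hv' in Hb; exact Hb]. }
  assert (b' = a \/ b' = b).
  { destruct H' as [->| ->]; [apply Hu in Hb'; tauto | apply Hv in Hb'; exact Hb']. }
  intuition congruence.
Qed.

Lemma related_pair (r p a b : M) : m_opair p a b -> m_related r a b -> p ∈ r.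
Proof. intros Hp (q & Hq & Hqr); rewrite (opair_unique _ _ _ _ Hp Hq); exact Hqr. Qed.

Lemma related_domain (r A B a b : M) :
  m_relation r A B -> m_related r a b -> a ∈ A /\ b ∈ B.
Proof.
  intros Hr (p & Hp & Hpr); destruct (Hr p Hpr) as (x & y & Hx & Hy & Hxy).
  destruct (opair_injective _ _ _ _ _ Hp Hxy) as [-> ->]; auto.
Qed.

(** ** Definable relations and functions *)

(** The ordered pairs of elements of [A] and [B] all lie in the double power set
    of their union, from which separation cuts out the relation. *)
Lemma relation_exists (R : M -> M -> Prop) (A B : M) : definable2 R ->
  exists r, m_relation r A B /\
    forall x y, m_related r x y <-> x ∈ A /\ y ∈ B /\ R x y.
Proof.
  intros (b & l & Hb).
  destruct (pairing_in A B) as [AB HAB], (union_in AB) as [U HU].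
  destruct (power_in U) as [P HP], (power_in P) as [PP HPP].
  destruct (separation_in
    (fun p => exists x y, m_opair p x y /\ (x ∈ A /\ y ∈ B /\ R x y))) with PP as [r Hr].
  { (* [A] and [B] become the last two parameters, after those of [R]. *)
    exists (let k := length l in
      fun p => (∃ x y, is_opair p x y /\ (x ∈ k /\ y ∈ S k /\ b x y))%zf).
    exists (l ++ [A; B]); intros n e p a Hl Hp.
    assert (H : carries n e l /\ at_level n e (length l) A /\
                at_level n e (S (length l)) B).
    { split; [|split].
      - intros i c Hi; apply Hl; rewrite nth_error_app1; [exact Hi|].
        apply nth_error_Some; congruence.
      - apply Hl; rewrite nth_error_app2, Nat.sub_diag by lia; reflexivity.
      - apply Hl; rewrite nth_error_app2 by lia.
        replace (S (length l) - length l) with 1 by lia; reflexivity. }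
    destruct H as (H1 & H2 & H3); clear Hl. express.
    apply Hb; [do 2 apply carries_under; exact H1 | find_level | find_level]. }
  assert (HrR : forall x y, m_related r x y <-> x ∈ A /\ y ∈ B /\ R x y).
  { intros x y; split.
    - intros (p & Hp & Hpr); apply Hr in Hpr as (_ & x' & y' & Hp' & H).
      destruct (opair_injective _ _ _ _ _ Hp Hp') as [-> ->]; exact H.
    - intros H; destruct (opair_exists x y) as [p Hp]; exists p; split; [exact Hp|].
      apply Hr; split; [|exists x, y; auto].
      assert (HxU : x ∈ U) by (apply HU; exists A; split; [apply HAB|]; tauto).
      assert (HyU : y ∈ U) by (apply HU; exists B; split; [apply HAB|]; tauto).
      destruct Hp as (u & v & Hu & Hv & Hp).
      apply HPP; intros c Hc; apply HP; intros d Hd.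
      apply Hp in Hc as [-> | ->]; [apply Hu in Hd | apply Hv in Hd];
        destruct Hd as [-> | ->]; assumption. }
  exists r; split; [|exact HrR].
  intros p Hp; pose proof Hp as Hp'; apply Hr in Hp' as (_ & x & y & Hxy & H).
  exists x, y; tauto.
Qed.

Lemma function_exists (R : M -> M -> Prop) (A B : M) : definable2 R ->
  (forall x, x ∈ A -> exists y, y ∈ B /\ R x y) ->
  (forall x y y', x ∈ A -> R x y -> R x y' -> y = y') ->
  exists f, m_function f A B /\
    forall x y, m_related f x y <-> x ∈ A /\ y ∈ B /\ R x y.
Proof.
  intros HR Htot Huniq; destruct (relation_exists R A B HR) as (f & Hf & HfR).
  exists f; split; [split; [exact Hf|]|exact HfR].
  intros x Hx; destruct (Htot x Hx) as (y & Hy & Hxy); exists y; split.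
  - apply HfR; auto.
  - intros y' Hy'; apply HfR in Hy' as (_ & _ & Hy'); eauto.
Qed.

Lemma function_value (f A B x y y' : M) :
  m_function f A B -> m_related f x y -> m_related f x y' -> y = y'.
Proof.
  intros [Hr Hf] Hy Hy'; destruct (related_domain _ _ _ _ _ Hr Hy) as [Hx _].
  destruct (Hf x Hx) as (y0 & _ & Hu); rewrite (Hu y Hy), (Hu y' Hy'); reflexivity.
Qed.

(** ** Natural numbers *)

Lemma omega_induction (P : M -> Prop) (w : M) : definable P -> m_omega w ->
  (forall z, m_empty z -> P z) ->
  (forall n m, P n -> m_succ m n -> P m) ->
  forall n, n ∈ w -> P n.
Proof.
  intros HP [Hw Hmin] H0 HS n Hn.
  destruct (separation_in P HP w) as [v Hv].
  assert (Hind : m_inductive v).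
  { destruct Hw as [(e & He & Hew) Hsucc]; split.
    - exists e; split; [exact He|]; apply Hv; auto.
    - intros x Hx; apply Hv in Hx as [Hxw HPx].
      destruct (Hsucc x Hxw) as (y & Hy & Hyw); exists y; split; [exact Hy|].
      apply Hv; split; [exact Hyw|]; eauto. }
  apply Hv, (Hmin v Hind n Hn).
Qed.

Lemma omega_zero_le (w z n : M) : m_omega w -> m_empty z -> n ∈ w -> z ∈ n \/ z = n.
Proof.
  intros Hw Hz; revert n.
  apply (omega_induction (fun n => z ∈ n \/ z = n) w); [| exact Hw | |].
  - exists ((fun z n => (z ∈ n \/ z = n)%zf) 0), [z]; express.
  - intros z' Hz'; right; apply set_ext; intros c; split; intros Hc.
    + destruct (Hz c Hc).
    + destruct (Hz' c Hc).
  - intros n m [H|H] Hm; left; apply Hm; auto.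
Qed.

Lemma omega_succ_le (w n : M) : m_omega w -> n ∈ w ->
  forall m s, m ∈ n -> m_succ s m -> s ∈ n \/ s = n.
Proof.
  intros Hw; revert n.
  apply (omega_induction (fun n => forall m s, m ∈ n -> m_succ s m -> s ∈ n \/ s = n) w);
    [| exact Hw | |].
  - exists (fun n => (∀ m s, m ∈ n -> is_succ s m -> s ∈ n \/ s = n)%zf), []; express.
  - intros z Hz m s Hm; destruct (Hz m Hm).
  - intros n n' IH Hn' m s Hm Hs; apply Hn' in Hm as [Hm| ->].
    + left; apply Hn'; eauto.
    + right; apply set_ext; intros c; rewrite (Hs c), (Hn' c); reflexivity.
Qed.

(** Induction on [n] with [m] fixed. If [m] is at most [n], it lies below the
    successor of [n]; if [n ∈ m], that successor is at most [m] by
    [omega_succ_le]. The base case is [omega_zero_le]. *)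
Lemma omega_trichotomy (w m n : M) : m_omega w -> m ∈ w -> n ∈ w ->
  m ∈ n \/ m = n \/ n ∈ m.
Proof.
  intros Hw Hm; revert n.
  apply (omega_induction (fun n => m ∈ n \/ m = n \/ n ∈ m) w); [| exact Hw | |].
  - exists ((fun m n => (m ∈ n \/ m = n \/ n ∈ m)%zf) 0), [m]; express.
  - intros z Hz; destruct (omega_zero_le w z m Hw Hz Hm); auto.
  - intros n n' [H|[H|H]] Hn'.
    + left; apply Hn'; auto.
    + left; apply Hn'; auto.
    + destruct (omega_succ_le w m Hw Hm n n' H Hn'); auto.
Qed.

(** ** Countable choice solves countable problems *)

(** The set attached to [n] is defined by a universal condition on the instances of
    index [n]. So it is all of [S] when there is no such instance, and a single
    formula defines a family of nonempty sets indexed by the whole of ω. *)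
Lemma choice_solves : @m_choice M -> @m_veloso_solvable M.
Proof.
  intros AC I S σ (Hσ & _ & [t0 Ht0] & Hvia & _) (w & g & Hw & [Hg Hinj]).
  pose (solvers (n A : M) := forall s, s ∈ A <-> s ∈ S /\
    forall z, m_related g z n -> m_related σ z s).
  destruct (power_in S) as [PS HPS].
  destruct (separation_in (fun A => exists n, n ∈ w /\ solvers n A)) with PS as [F HF].
  { exists ((fun w g S σ A => (∃ n, n ∈ w /\ ∀ s, s ∈ A <-> s ∈ S /\
       ∀ z, related g z n -> related σ z s)%zf) 0 1 2 3), [w; g; S; σ].
    unfold solvers; express. }
  assert (Hsolvers : forall n, n ∈ w -> exists A, A ∈ F /\ solvers n A).
  { intros n Hn.
    destruct (separation_in
      (fun s => forall z, m_related g z n -> m_related σ z s)) with S as [A HA].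
    - exists ((fun n g σ s => (∀ z, related g z n -> related σ z s)%zf) 0 1 2), [n; g; σ].
      express.
    - exists A; split; [|exact HA]. apply HF; split; [|exists n; auto].
      apply HPS; intros s Hs; apply HA in Hs; tauto. }
  destruct (function_exists solvers w F) as (X & HX & HXsolvers).
  { exists ((fun g S σ n A => (∀ s, s ∈ A <-> s ∈ S /\
       ∀ z, related g z n -> related σ z s)%zf) 0 1 2), [g; S; σ].
    unfold solvers; express. }
  { exact Hsolvers. }
  { intros n A A' _ HA HA'; apply set_ext; intros s; rewrite (HA s), (HA' s); reflexivity. }
  destruct (union_in F) as [U HU].
  destruct (AC w F X U Hw HX) as (f & Hf & Hchoice); [| |exact HU|].
  { intros A HA; pose proof HA as HA'; apply HF in HA' as (_ & n & Hn & Hs).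
    exists n; split; [exact Hn|]; apply HXsolvers; auto. }
  { intros n A Hn HA; apply HXsolvers in HA as (_ & _ & HA).
    destruct (classic (exists z, m_related g z n)) as [[z Hz]|Hno].
    - destruct (related_domain _ _ _ _ _ (proj1 Hg) Hz) as [HzI _].
      destruct (Hvia z HzI) as (s & HsS & Hs); exists s; apply HA; split; [exact HsS|].
      intros z' Hz'; rewrite (Hinj _ _ _ Hz' Hz); exact Hs.
    - exists t0; apply HA; split; [exact Ht0|]. intros z Hz; exfalso; eauto. }
  destruct (function_exists (fun z s => exists n A,
    m_related g z n /\ m_related X n A /\ m_related f A s) I S) as (h & Hh & Hhf).
  { exists ((fun g X f z s => (∃ n A, related g z n /\ related X n A /\ related f A s)%zf)
      0 1 2), [g; X; f]; express. }
  { intros z Hz; destruct (proj2 Hg z Hz) as (n & Hn & _).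
    destruct (related_domain _ _ _ _ _ (proj1 Hg) Hn) as [_ Hnw].
    destruct (proj2 HX n Hnw) as (A & HA & _).
    destruct (related_domain _ _ _ _ _ (proj1 HX) HA) as [_ HAF].
    destruct (proj2 Hf A HAF) as (s & Hs & _); exists s; split; [|exists n, A; auto].
    pose proof (Hchoice n A s Hnw HA Hs) as HsA.
    apply HXsolvers in HA as (_ & _ & HA); apply HA in HsA; tauto. }
  { intros z s s' _ (n & A & Hn & HA & Hs) (n' & A' & Hn' & HA' & Hs').
    rewrite <- (function_value _ _ _ _ _ _ Hg Hn Hn') in HA'.
    rewrite <- (function_value _ _ _ _ _ _ HX HA HA') in Hs'.
    exact (function_value _ _ _ _ _ _ Hf Hs Hs'). }
  exists h; split; [exact Hh|].
  intros p Hp; destruct (proj1 Hh p Hp) as (z & s & _ & _ & Hzs).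
  apply related_pair with z s; [exact Hzs|].
  assert (H : m_related h z s) by (exists p; auto).
  apply Hhf in H as (_ & _ & n & A & Hn & HA & Hs).
  destruct (related_domain _ _ _ _ _ (proj1 Hg) Hn) as [_ Hnw].
  pose proof (Hchoice n A s Hnw HA Hs) as HsA.
  apply HXsolvers in HA as (_ & _ & HA); apply HA in HsA as [_ HsA]; auto.
Qed.

(** ** Solutions of countable problems give countable choice *)

(** Each member of an enumerated family is sent to its least index: foundation
    yields an ∈-minimal index, and trichotomy makes it unique. *)
Lemma enumerated_countable (w X F : M) : m_omega w -> m_function X w F ->
  (forall x, x ∈ F -> exists n, n ∈ w /\ m_related X n x) -> m_countable F.
Proof.
  intros Hw HX Honto.
  destruct (function_exists (fun x n => m_related X n x /\
      forall k, m_related X k x -> ~ k ∈ n) F w) as (i & Hi & Hindex).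
  - exists ((fun X x n => (related X n x /\ ∀ k, related X k x -> ~ k ∈ n)%zf) 0), [X].
    express.
  - intros x Hx.
    destruct (separation_in (fun n => m_related X n x)) with w as [D HD].
    { exists ((fun X x n => related X n x) 0 1), [X; x]; express. }
    destruct (foundation_in D) as (n & Hn & Hleast).
    { destruct (Honto x Hx) as (n & Hn); exists n; apply HD, Hn. }
    apply HD in Hn as [Hnw Hn]; exists n; split; [exact Hnw|]; split; [exact Hn|].
    intros k Hk Hkn; apply Hleast; exists k; split; [|exact Hkn].
    apply HD; split; [|exact Hk]. apply (related_domain _ _ _ _ _ (proj1 HX) Hk).
  - intros x n n' _ [Hn Hmin] [Hn' Hmin'].
    destruct (related_domain _ _ _ _ _ (proj1 HX) Hn) as [Hnw _].
    destruct (related_domain _ _ _ _ _ (proj1 HX) Hn') as [Hnw' _].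
    destruct (omega_trichotomy w n n' Hw Hnw Hnw') as [H|[H|H]]; [|exact H|].
    + destruct (Hmin' n Hn H).
    + destruct (Hmin n' Hn' H).
  - exists w, i; split; [exact Hw|]; split; [exact Hi|].
    intros x x' n Hx Hx'; apply Hindex in Hx as (_ & _ & Hx & _), Hx' as (_ & _ & Hx' & _).
    exact (function_value _ _ _ _ _ _ HX Hx Hx').
Qed.

(** Membership, read as the relation of a set to its solutions, makes choice
    functions and solution functions the same thing. *)
Lemma solutions_choose : @m_veloso_solvable M -> @m_choice M.
Proof.
  intros Hsolv w F X U Hw HX Honto Hne HU.
  assert (Hin : forall x t, x ∈ F -> t ∈ x -> t ∈ U).
  { intros x t Hx Ht; apply HU; eauto. }
  assert (HneF : forall x, x ∈ F -> m_nonempty x).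
  { intros x Hx; destruct (Honto x Hx) as (n & Hn & Hnx); eauto. }
  assert (HF : m_nonempty F).
  { destruct Hw as [[(e & _ & He) _] _].
    destruct (proj2 HX e He) as (x & Hx & _); exists x.
    apply (related_domain _ _ _ _ _ (proj1 HX) Hx). }
  assert (Hgoal : exists f, m_function f F U /\ forall x y, m_related f x y -> y ∈ x).
  { (* A generic problem is not a Veloso problem, but has a constant solution. *)
    destruct (classic (exists t, t ∈ U /\ forall x, x ∈ F -> t ∈ x))
      as [(t & HtU & Ht)|Hno].
    - destruct (function_exists (fun _ y => y = t) F U) as (f & Hf & Hft).
      + exists ((fun t x y => (y = t)%zf) 0), [t]; express.
      + eauto.
      + intros x y y' _ -> ->; reflexivity.
      + exists f; split; [exact Hf|].
        intros x y Hxy; apply Hft in Hxy as (Hx & _ & ->); auto.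
    - destruct (relation_exists (fun x t => t ∈ x) F U) as (σ & Hσ & Hσin).
      { exists (fun x t => (t ∈ x)%zf), []; express. }
      destruct (Hsolv F U σ) as (f & Hf & Hfσ).
      + split; [exact Hσ|]; split; [exact HF|]; split; [|split].
        * destruct HF as [x Hx], (HneF x Hx) as [t Ht]; exists t; eauto.
        * intros x Hx; destruct (HneF x Hx) as [t Ht].
          exists t; split; [eauto|]; apply Hσin; eauto.
        * intros t Ht; apply NNPP; intros Hall; apply Hno; exists t; split; [exact Ht|].
          intros x Hx; apply NNPP; intros Htx; apply Hall; exists x; split; [exact Hx|].
          intros H; apply Hσin in H; tauto.
      + exact (enumerated_countable w X F Hw HX Honto).
      + exists f; split; [exact Hf|].
        intros x y (p & Hp & Hpf); assert (H : m_related σ x y) by (exists p; auto).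
        apply Hσin in H; tauto. }
  destruct Hgoal as (f & Hf & Hfin); exists f; split; [exact Hf|]; eauto.
Qed.

End Model.

Theorem theorem3p15 : provable ZF (Iff AC_omega countable_veloso_solvable).
Proof.
  apply completeness; [exact ZF_closed|].
  intros M HM e.
  enough (H : sat e AC_omega <-> sat e countable_veloso_solvable) by (cbn; tauto).
  rewrite sat_AC_omega, sat_countable_veloso_solvable; split.
  - apply choice_solves, HM.
  - apply solutions_choose, HM.
Qed.
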